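(* Let $G$ and $H$ be finite simple graphs. Then the automorphism group $\mathrm{Aut}(G)$ is (isomorphic to) a subgroup of the automorphism group of $G\times H$.
   Context: $\mathrm{Aut}(G)$ denotes the group of graph automorphisms of $G$. Product: for finite simple graphs $G,H$, the graph $G\times H$ has as vertices all pairs $(x,y)$ with $x$ a nonempty complete subgraph (simplex, identified with its vertex set) of $G$ and $y$ a nonempty complete subgraph of $H$. Two distinct vertices $(x,y)\neq(x',y')$ are adjacent iff ($x\subseteq x'$ and $y\subseteq y'$) or ($x'\subseteq x$ and $y'\subseteq y$).
   Formalization: The graph H is assumed to have at least one vertex; for empty H the product G×H is empty and has trivial automorphism group, so the claim fails, e.g. for G two isolated vertices. *)

(* Defs.v *)
From HB Require Import structures.
From mathcomp Require Import all_boot all_fingroup.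

Set Implicit Arguments.
Unset Strict Implicit.
Unset Printing Implicit Defensive.

Record sgraph := SGraph {
  vertex :> finType;
  adj : rel vertex;
  adj_sym : symmetric adj;
  adj_irrefl : irreflexive adj
}.

Section Automorphisms.
Variable G : sgraph.

(* Since s is a permutation of a finite set, asking for an equivalence (rather
   than an implication) makes both s and its inverse adjacency-preserving. *)
Definition graph_aut : {set {perm G}} :=
  [set s : {perm G} | [forall x, forall y, adj (s x) (s y) == adj x y]].

Lemma graph_autP (s : {perm G}) :
  reflect (forall x y, adj (s x) (s y) = adj x y) (s \in graph_aut).
Proof.
rewrite inE; apply: (iffP forallP) => [H x y|H x].
  by have /forallP/(_ y)/eqP := H x.
by apply/forallP => y; rewrite H.
Qed.

Lemma graph_aut_group_set : group_set graph_aut.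
Proof.
apply/group_setP; split=> [|s t /graph_autP Hs /graph_autP Ht].
  by apply/graph_autP => x y; rewrite !perm1.
by apply/graph_autP => x y; rewrite !permM Ht Hs.
Qed.

Canonical graph_aut_group : {group {perm G}} := Group graph_aut_group_set.

Definition simplex (x : {set G}) : bool :=
  (x != set0) && [forall a in x, forall b in x, (a != b) ==> adj a b].

End Automorphisms.

Section Product.
Variables G H : sgraph.

Definition prod_vertex : finType :=
  {p : {set G} * {set H} | simplex p.1 && simplex p.2}.

Definition prod_adj : rel prod_vertex := fun p q =>
  let: (x, y) := val p in
  let: (x', y') := val q in
  (p != q) &&
  ((x \subset x') && (y \subset y') || (x' \subset x) && (y' \subset y)).

Lemma prod_adj_sym : symmetric prod_adj.
Proof.
move=> p q; rewrite /prod_adj eq_sym.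
by case: (val p) => x y; case: (val q) => x' y'; rewrite orbC.
Qed.

Lemma prod_adj_irrefl : irreflexive prod_adj.
Proof. by move=> p; rewrite /prod_adj eqxx; case: (val p). Qed.

Definition graph_prod : sgraph := SGraph prod_adj_sym prod_adj_irrefl.

End Product.

(* Main.v *)
(* An automorphism s acts on the product by (x, y) |-> (s(x), y), which preserves
   simplices and inclusions. The action is faithful because every ({a}, {b})
   is a vertex of the product; this is where a vertex b of H is needed. *)
Require Import Defs.
From mathcomp Require Import all_boot all_fingroup.

Set Implicit Arguments.
Unset Strict Implicit.
Unset Printing Implicit Defensive.

Local Open Scope group_scope.

Lemma simplex1 (G : sgraph) (a : G) : simplex [set a].
Proof.
apply/andP; split; first by apply/set0Pn; exists a; rewrite set11.
apply/forall_inP => b /set1P ->; apply/forall_inP => c /set1P ->.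
by rewrite eqxx.
Qed.

Lemma simplex_aut (G : sgraph) (s : {perm G}) (x : {set G}) :
  s \in graph_aut G -> simplex x -> simplex (s @: x).
Proof.
move=> /graph_autP sP /andP[/set0Pn[a ax] /forall_inP xP].
apply/andP; split; first by apply/set0Pn; exists (s a); apply: imset_f.
apply/forall_inP => _ /imsetP[b bx ->]; apply/forall_inP => _ /imsetP[c cx ->].
by rewrite sP (inj_eq perm_inj); apply: (forall_inP (xP b bx)).
Qed.

Section LeftAction.
Variables (G : sgraph) (T : finType).

(** Taking arbitrary sets rather than simplices lets every permutation act, so the action laws need
    no simplex proofs. *)
Definition left_act (p : {set G} * T) (s : {perm G}) := (s @: p.1, p.2).

Lemma left_act1 p : left_act p 1 = p.
Proof.
case: p => x y; congr (_, _) => /=; rewrite -[RHS]imset_id.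
by apply: eq_imset => a; rewrite perm1.
Qed.

Lemma left_actM p : act_morph left_act p.
Proof.
move=> s t; congr (_, _); rewrite /= -imset_comp.
by apply: eq_imset => a; rewrite permM.
Qed.

Canonical left_action := TotalAction left_act1 left_actM.

End LeftAction.

Section ProductAction.
Variables G H : sgraph.

Let prod_pred (p : {set G} * {set H}) := simplex p.1 && simplex p.2.

(** The restriction to pairs of simplices is only partial: its domain is the stabilizer of the set
    of such pairs, and other permutations act trivially by default. *)
Definition prod_action :=
  @subaction _ _ _ prod_pred (prod_vertex G H) (left_action G {set H}).

Lemma graph_aut_acts :
  graph_aut G \subset subact_dom prod_pred (left_action G {set H}).
Proof.
apply/subsetP => s sP; rewrite !inE /=; apply/subsetP => -[x y].
by rewrite !inE /prod_pred /= => /andP[/(simplex_aut sP) -> ->].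
Qed.

Lemma val_prod_action (s : {perm G}) (p : graph_prod G H) :
  s \in graph_aut G ->
  val (actperm prod_action s p) = (s @: (val p).1, (val p).2).
Proof. by move=> /(subsetP graph_aut_acts) sD; rewrite actpermE val_subact sD. Qed.

(** Adjacency in the product is built from inequality and inclusions, and taking images under a
    bijection both preserves and reflects these. *)
Lemma actperm_graph_aut :
  actperm prod_action @* graph_aut G \subset graph_aut (graph_prod G H).
Proof.
apply/subsetP => _ /morphimP[s _ sP ->]; apply/graph_autP => p q.
rewrite /= /prod_adj (inj_eq perm_inj) !val_prod_action //.
have sub (A B : {set G}) : (s @: A \subset s @: B) = (A \subset B).
  apply/idP/idP => [/subsetP sAB|]; last exact: imsetS.
  by apply/subsetP => a aA; rewrite -(mem_imset B a (@perm_inj _ s)) sAB ?imset_f.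
by case: (val p) (val q) => [x y] [x' y'] /=; rewrite !sub.
Qed.

Lemma injm_actperm_graph_aut (b : H) :
  {in graph_aut G &, injective (actperm prod_action)}.
Proof.
move=> s t sP tP est; apply/permP => a.
have ab_vertex : prod_pred ([set a], [set b]) by rewrite /prod_pred !simplex1.
pose p : graph_prod G H := Sub ([set a], [set b]) ab_vertex.
(* The first components of the two images of [p] are the singletons of [s a] and [t a]. *)
have := congr1 (fun u : {perm graph_prod G H} => (val (u p)).1) est.
by rewrite /= !val_prod_action // SubK /= !imset_set1 => /set1_inj.
Qed.

End ProductAction.

Theorem lemma19 (G H : sgraph) (H_nonempty : 0 < #|H|) :
  exists2 K : {group {perm graph_prod G H}},
    K \subset graph_aut (graph_prod G H) & graph_aut G \isog K.
Proof.
have /card_gt0P[b _] := H_nonempty.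
exists (actperm (prod_action G H) @* graph_aut G)%G.
  exact: actperm_graph_aut.
have sAD := graph_aut_acts G H.
(* [sub_isog] wants injectivity on the whole domain of the morphism, but it is known on
   [graph_aut G]; hence the domain is first cut down to that group. *)
rewrite /= -(im_restrm sAD).
apply: sub_isog => //.
by apply/injmP => s t sP tP; apply: (injm_actperm_graph_aut b).
Qed.
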